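(* Let $T>0$, $I=[0,T]$, let $\kappa\in\mathscr{K}_{\mathrm{reg}}$ be a regular admissible kernel and let $\Lambda\in\mathscr{A}(I)$ be an adaptive sensitivity function. Equip $\mathcal{C}(I)$ with the supremum norm $\|\cdot\|_\infty$ and $\mathscr{M}_{\kappa,\Lambda}(I)$ with the functional $S_{\kappa,\Lambda}$. The identity mapping $\iota:\mathcal{C}(I)\to\mathscr{M}_{\kappa,\Lambda}(I)$, $\iota(f)=f$, satisfies: (i) $\iota$ is linear. (ii) With the constant $C=1+\Lambda_\infty\kappa_\infty T$, where $\Lambda_\infty:=\sup_{(s,x)\in I\times\mathbb{R}}\Lambda(s,x)$ and $\kappa_\infty:=\sup_{\tau\in I}\kappa(\tau)$, one has $S_{\kappa,\Lambda}(\iota(f))\le C\|f\|_\infty$ for all $f\in\mathcal{C}(I)$. (iii) $\iota$ is uniformly continuous (in fact Lipschitz): for any $f,g\in\mathcal{C}(I)$, $$S_{\kappa,\Lambda}(\iota(f)-\iota(g))\le C\|f-g\|_\infty.$$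
   Context: Fix $T>0$ and $I=[0,T]$. $\mathcal{C}(I)$ is the set of continuous functions $I\to\mathbb{R}$ and $\|f\|_\infty:=\sup_{t\in I}|f(t)|$. Regular admissible kernels: $\mathscr{K}_{\mathrm{reg}}$ is the set of Lebesgue measurable, integrable functions $\kappa:I\to[0,\infty)$ such that (uniform boundedness) there are constants $0<m_\kappa\le M_\kappa<\infty$ with $m_\kappa\le\kappa(\tau)\le M_\kappa$ for all $\tau\in I$; (normalization) $\int_0^T\kappa(\tau)\,d\tau=1$; (Lipschitz continuity) there is $L_\kappa>0$ with $|\kappa(\tau_1)-\kappa(\tau_2)|\le L_\kappa|\tau_1-\tau_2|$ for all $\tau_1,\tau_2\in I$. Adaptive sensitivity functions: $\mathscr{A}(I)$ is the set of functions $\Lambda:I\times\mathbb{R}\to[0,\infty)$ such that: there are constants $0<\lambda_{\min}\le\lambda_{\max}<\infty$ with $\lambda_{\min}\le\Lambda(s,x)\le\lambda_{\max}$ for all $(s,x)\in I\times\mathbb{R}$; there is $L_\Lambda>0$ with $|\Lambda(s,x)-\Lambda(s,y)|\le L_\Lambda|x-y|$ for all $s\in I$, $x,y\in\mathbb{R}$; for every fixed $x\in\mathbb{R}$, $s\mapsto\Lambda(s,x)$ is Lebesgue measurable on $I$; there is $\varrho>0$ with $\Lambda(s,0)\ge\varrho$ for all $s\in I$. Adaptive memory-dependent functional: for a function $f:I\to\mathbb{R}$ for which the integrals below exist as Lebesgue integrals for every $t\in I$, $$S_{\kappa,\Lambda}(f):=\sup_{t\in I}\left(|f(t)|+\int_0^t\Lambda(s,f(s))\,\kappa(t-s)\,|f(s)|\,ds\right).$$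 Adaptive memory-dependent sensitivity set: $\mathscr{M}_{\kappa,\Lambda}(I):=\{f:I\to\mathbb{R}\mid S_{\kappa,\Lambda}(f)<\infty\}$, i.e. the set of functions for which $S_{\kappa,\Lambda}(f)$ is well-defined (the integrals exist as Lebesgue integrals) and finite. Conventions: addition, subtraction and scalar multiplication of functions are pointwise; linearity of $\iota$ means $\iota(\alpha f+\beta g)=\alpha\iota(f)+\beta\iota(g)$ for all $f,g\in\mathcal{C}(I)$, $\alpha,\beta\in\mathbb{R}$. Uniform continuity of $\iota$ means: for every $\varepsilon>0$ there is $\delta>0$ such that $S_{\kappa,\Lambda}(\iota(f)-\iota(g))<\varepsilon$ whenever $f,g\in\mathcal{C}(I)$ and $\|f-g\|_\infty<\delta$. *)

(* Defs.v *)
From mathcomp Require Import all_boot all_order all_algebra.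
From mathcomp Require Import all_classical all_reals all_analysis.

Set Implicit Arguments.
Unset Strict Implicit.
Unset Printing Implicit Defensive.
Import Order.TTheory GRing.Theory Num.Theory.
Import numFieldNormedType.Exports.
Local Open Scope classical_set_scope.
Local Open Scope ring_scope.

(* A function on [I = [0, T]] is represented by a function [R -> R]; the
   definitions below depend only on its values on [I].  [lebesgue_measure] lives
   on the Borel sets, so Lebesgue measurability and Lebesgue integrals are taken
   with respect to its completion [completed_lebesgue_measure]. *)

Definition lebesgue_measurable_fun {R : realType} (D : set R) (f : R -> R) :=
  @measurable_fun _ _ (caratheodory_type (wlength (@idfun R))^*%mu) R D f.

Definition continuous_set {R : realType} (T : R) : set (R -> R) :=
  [set f | {within `[0, T], continuous f}].

Definition sup_norm {R : realType} (T : R) (f : R -> R) : R :=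
  sup [set `|f t| | t in `[0, T]].

Record regular_kernel {R : realType} (T : R) (kappa : R -> R) : Prop := {
  kernel_ge0 : forall tau, tau \in `[0, T] -> 0 <= kappa tau;
  kernel_measurable : lebesgue_measurable_fun `[0, T] kappa;
  kernel_integrable :
    (@completed_lebesgue_measure R).-integrable `[0, T]
      (fun tau => (kappa tau)%:E);
  kernel_bounded : exists m M : R, [/\ 0 < m, m <= M &
    forall tau, tau \in `[0, T] -> m <= kappa tau <= M];
  kernel_normalized :
    (\int[@completed_lebesgue_measure R]_(tau in `[0%R, T]) (kappa tau)%:E
      = 1)%E;
  kernel_lipschitz : exists2 L : R, 0 < L &
    forall tau1 tau2, tau1 \in `[0, T] -> tau2 \in `[0, T] ->
      `|kappa tau1 - kappa tau2| <= L * `|tau1 - tau2| }.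

Record adaptive_sensitivity {R : realType} (T : R) (Lambda : R -> R -> R)
    : Prop := {
  sensitivity_ge0 : forall s x, s \in `[0, T] -> 0 <= Lambda s x;
  sensitivity_bounded : exists lmin lmax : R, [/\ 0 < lmin, lmin <= lmax &
    forall s x, s \in `[0, T] -> lmin <= Lambda s x <= lmax];
  sensitivity_lipschitz : exists2 L : R, 0 < L &
    forall s x y, s \in `[0, T] ->
      `|Lambda s x - Lambda s y| <= L * `|x - y|;
  sensitivity_measurable : forall x,
    lebesgue_measurable_fun `[0, T] (fun s => Lambda s x);
  sensitivity_at0 : exists2 rho : R, 0 < rho &
    forall s, s \in `[0, T] -> rho <= Lambda s 0 }.

Definition memory_integrand {R : realType} (kappa : R -> R)
    (Lambda : R -> R -> R) (f : R -> R) (t s : R) : \bar R :=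
  (Lambda s (f s) * kappa (t - s) * `|f s|)%:E.

Definition memory_functional_defined {R : realType} (T : R) (kappa : R -> R)
    (Lambda : R -> R -> R) (f : R -> R) : Prop :=
  forall t, t \in `[0, T] ->
    (@completed_lebesgue_measure R).-integrable `[0, t]
      (memory_integrand kappa Lambda f t).

(* Meaningful only for functions satisfying [memory_functional_defined]. *)
Definition memory_functional {R : realType} (T : R) (kappa : R -> R)
    (Lambda : R -> R -> R) (f : R -> R) : \bar R :=
  ereal_sup [set (`|f t|%:E +
    \int[@completed_lebesgue_measure R]_(s in `[0%R, t])
      memory_integrand kappa Lambda f t s)%E | t in `[0, T]].

Definition memory_set {R : realType} (T : R) (kappa : R -> R)
    (Lambda : R -> R -> R) : set (R -> R) :=
  [set f | memory_functional_defined T kappa Lambda f /\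
           (memory_functional T kappa Lambda f < +oo)%E].

Definition memory_embedding {R : realType} (f : R -> R) : R -> R := f.

Definition kernel_sup {R : realType} (T : R) (kappa : R -> R) : R :=
  sup [set kappa tau | tau in `[0, T]].

Definition sensitivity_sup {R : realType} (T : R) (Lambda : R -> R -> R) : R :=
  sup [set Lambda p.1 p.2 | p in `[0, T] `*` [set: R]].

Definition memory_constant {R : realType} (T : R) (kappa : R -> R)
    (Lambda : R -> R -> R) : R :=
  1 + sensitivity_sup T Lambda * kernel_sup T kappa * T.

(* Main.v *)
Require Import Defs.
From mathcomp Require Import all_boot all_order all_algebra.
From mathcomp Require Import all_classical all_reals all_analysis.
From mathcomp Require Import measurable_realfun.
From mathcomp Require Import lra.
Import Order.TTheory GRing.Theory Num.Theory.
Import numFieldNormedType.Exports.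
Local Open Scope classical_set_scope.
Local Open Scope ring_scope.

(** For continuous [f] and [0 <= s <= t <= T], the memory integrand
    [Lambda s (f s) * kappa (t - s) * `|f s|] lies between [0] and the constant
    [Lambda_oo * kappa_oo * `|f|_oo]. Integrating over [`[0, t]], whose length
    is at most [T], and adding [`|f t| <= `|f|_oo] bounds the functional by
    [(1 + Lambda_oo * kappa_oo * T) * `|f|_oo] ([memory_functional_le]).
    This estimate concerns one continuous function at a time; as [C(I)] is a
    linear space, applying it to [f \- g] gives the Lipschitz estimate, and
    uniform continuity follows with [delta = eps / C].

    The integrals must also exist
    ([memory_functional_defined_continuous]). The integrand is bounded on an
    interval of finite length, so only its measurability is at stake, and the
    delicate factor is [s |-> Lambda s (f s)]: [Lambda] is merely measurable in
    [s] for each fixed [x]. The uniform Lipschitz bound in [x] makes up for it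
    ([measurable_fun_caratheodory_comp]). The kernel factor
    [s |-> kappa (t - s)] is measurable because it is Lipschitz, hence
    continuous on [`[0, t]]. *)

(** * Measurability *)

Lemma lipschitz_within_continuous (R : realType) (A : set R) (f : R -> R)
    (L : R) :
  (forall x y, A x -> A y -> `|f x - f y| <= L * `|x - y|) ->
  {within A, continuous f}.
Proof.
move=> fL; apply/subspace_continuousP => x Ax.
apply/cvgrPdist_le => e e0.
have L0 : 0 < `|L| + 1 by rewrite ltr_wpDl.
have d0 : 0 < e / (`|L| + 1) by rewrite divr_gt0.
apply/nbhs_ballP; exists (e / (`|L| + 1)) => //= y xy Ay.
apply: le_trans (fL _ _ Ax Ay) _; move/ltW: xy => xy.
rewrite ler_pdivlMr// mulrC in xy; apply: le_trans xy.
by rewrite ler_wpM2r// (le_trans (ler_norm L))// lerDl.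
Qed.

(** The completed measure lives on the Caratheodory sigma-algebra, which
    contains the Borel sets. *)
Lemma measurable_fun_lebesgue (R : realType) (D : set R) (f : R -> R) :
  measurable D -> measurable_fun D f -> lebesgue_measurable_fun D f.
Proof. by move=> mD mf _ Y mY; apply: sub_caratheodory; exact: mf. Qed.

Lemma lebesgue_measurable_funS {R : realType} {D E : set R} {f : R -> R} :
  measurable E -> D `<=` E -> lebesgue_measurable_fun E f ->
  lebesgue_measurable_fun D f.
Proof.
move=> mE DE mf.
refine (@measurable_funS _ _
  (caratheodory_type (wlength (@idfun R))^*%mu) _ E D f _ DE mf).
exact: sub_caratheodory.
Qed.

(** By the Lipschitz bound, [F s (g s)] is the infimum over rational [q] of
    [F s q + L * `|g s - q|], a countable family of measurable functions of
    [s]; on sublevel sets, this infimum is a union over [q]. *)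
Lemma measurable_fun_caratheodory_comp {d} {X : measurableType d} {R : realType}
    {D : set X} {F : X -> R -> R} {g : X -> R} {L : R} : 0 < L ->
  (forall s x y, D s -> `|F s x - F s y| <= L * `|x - y|) ->
  (forall x, measurable_fun D (F ^~ x)) -> measurable_fun D g ->
  measurable_fun D (fun s => F s (g s)).
Proof.
move=> L0 FL mF mg mD.
apply: (measurability _ (RGenInftyO.measurableE R)) => //.
move=> _ [_ [x ->] <-].
rewrite [X in measurable X](_ : _ = \bigcup_(q : rat)
  (D `&` [set s | F s (ratr q) + L * `|g s - ratr q| < x])).
  apply: bigcupT_measurable_rat => q.
  rewrite -preimage_itvNyo.
  have mh : measurable_fun D (fun s => F s (ratr q) + L * `|g s - ratr q|).
    apply: measurable_funD; first exact: mF.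
    apply: measurable_funM => //.
    apply: measurableT_comp => //.
    exact: measurable_funB.
  by apply: mh => //; exact: measurable_itv.
rewrite preimage_itvNyo; apply/seteqP.
split => [s [Ds /= Fs]|s [q _ [Ds /= Fs]]].
  (* [F s q <= F s (g s) + L * `|g s - q|], so the term of index [q] exceeds
     [F s (g s)] by at most [2 * L * `|g s - q|]. *)
  pose e := (x - F s (g s)) / (2 * L).
  have e0 : 0 < e by rewrite divr_gt0 ?subr_gt0 ?mulr_gt0.
  have [|q] := @rat_in_itvoo R (g s - e) (g s + e); first by lra.
  rewrite in_itv/= -ltr_distl distrC => qs.
  exists q => //; split => //=.
  have := FL s (ratr q) (g s) Ds.
  move: qs; rewrite ltr_pdivlMr ?mulr_gt0// (distrC (ratr q)) => qs.
  by move/(le_trans (ler_norm _)) => ?; lra.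
split => //=.
have := FL s (g s) (ratr q) Ds.
by move/(le_trans (ler_norm _)) => ?; lra.
Qed.

(** * Continuous functions and the supremum norm *)

Section sup_norm_continuous.
Context {R : realType} {T : R} (T_gt0 : 0 < T).
Implicit Types f g : R -> R.

Lemma continuous_set_lin (a b : R) f g : continuous_set T f ->
  continuous_set T g -> continuous_set T (fun t => a * f t + b * g t).
Proof.
move=> cf cg x; apply: cvgD; apply: cvgM; try exact: cvg_cst.
- exact: cf.
- exact: cg.
Qed.

Lemma continuous_setB {f g} : continuous_set T f ->
  continuous_set T g -> continuous_set T (f \- g).
Proof. by move=> cf cg x; apply: cvgB; [exact: cf | exact: cg]. Qed.

(** The real-valued [sup] is an upper bound only of sets that are bounded
    above; here [`|f|] attains its maximum. *)
Lemma norm_le_sup_norm {f t} : continuous_set T f -> t \in `[0, T] ->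
  `|f t| <= sup_norm T f.
Proof.
move=> cf tT.
have cn : {within `[0, T], continuous (fun t => `|f t|)}.
  by move=> x; apply: cvg_norm; exact: cf.
have [c cT fc] := EVT_max (ltW T_gt0) cn.
apply: ub_le_sup; last by exists t.
by exists `|f c| => _ [s sT <-]; exact: fc.
Qed.

Lemma sup_norm_ge0 f : continuous_set T f -> 0 <= sup_norm T f.
Proof.
move=> cf; apply: le_trans (norm_le_sup_norm (t := 0) cf _).
  exact: normr_ge0.
by rewrite in_itv/= lexx ltW.
Qed.

End sup_norm_continuous.

(** * The memory functional of a continuous function *)

Section memory.
Context {R : realType} {T : R} {kappa : R -> R} {Lambda : R -> R -> R}.
Context (T_gt0 : 0 < T) (kappa_reg : regular_kernel T kappa).
Context (Lambda_adaptive : adaptive_sensitivity T Lambda).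

Lemma kernel_le_sup {tau} : tau \in `[0, T] -> kappa tau <= kernel_sup T kappa.
Proof.
move=> tauT; apply: ub_le_sup; last by exists tau.
have [m [M [_ _ kM]]] := kernel_bounded kappa_reg.
by exists M => _ [s /kM/andP[_ sM] <-].
Qed.

Lemma sensitivity_le_sup {s} x : s \in `[0, T] ->
  Lambda s x <= sensitivity_sup T Lambda.
Proof.
move=> sT; apply: ub_le_sup; last by exists (s, x).
have [m [M [_ _ LM]]] := sensitivity_bounded Lambda_adaptive.
by exists M => _ [[r y]/= [rT _] <-]; have /andP[] := LM r y rT.
Qed.

Lemma kernel_sup_ge0 : 0 <= kernel_sup T kappa.
Proof.
have T0 : 0 \in `[0, T] by rewrite in_itv/= lexx ltW.
exact: le_trans (kernel_ge0 kappa_reg T0) (kernel_le_sup T0).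
Qed.

Lemma sensitivity_sup_ge0 : 0 <= sensitivity_sup T Lambda.
Proof.
have T0 : 0 \in `[0, T] by rewrite in_itv/= lexx ltW.
apply: le_trans (sensitivity_ge0 Lambda_adaptive 0 T0) _.
exact: sensitivity_le_sup.
Qed.

Lemma memory_constant_gt0 : 0 < memory_constant T kappa Lambda.
Proof.
by rewrite ltr_pwDl// !mulr_ge0 ?sensitivity_sup_ge0 ?kernel_sup_ge0 ?ltW.
Qed.

Lemma memory_integrand_bounds {f t s} : continuous_set T f -> t \in `[0, T] ->
  s \in `[0, t] ->
  0 <= Lambda s (f s) * kappa (t - s) * `|f s|
    <= sensitivity_sup T Lambda * kernel_sup T kappa * sup_norm T f.
Proof.
move=> cf; rewrite !in_itv/= => /andP[t0 tT] /andP[s0 st].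
have sT : s \in `[0, T] by rewrite in_itv/= s0 (le_trans st).
have tsT : t - s \in `[0, T].
  by rewrite in_itv/= subr_ge0 st lerBlDr (le_trans tT)// lerDl.
have L0 := sensitivity_ge0 Lambda_adaptive (f s) sT.
have k0 := kernel_ge0 kappa_reg tsT.
rewrite !mulr_ge0//= ler_pM ?mulr_ge0 ?norm_le_sup_norm//.
by rewrite ler_pM ?sensitivity_le_sup ?kernel_le_sup.
Qed.

Lemma memory_integrand_measurable f t : continuous_set T f -> t \in `[0, T] ->
  lebesgue_measurable_fun `[0, t]
    (fun s => Lambda s (f s) * kappa (t - s) * `|f s|).
Proof.
move=> cf; rewrite in_itv/= => /andP[t0 tT].
have tTS : `[0, t] `<=` `[0, T].
  by move=> s /=; rewrite !in_itv/= => /andP[-> /le_trans->].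
have mf : lebesgue_measurable_fun `[0, t] f.
  apply: (lebesgue_measurable_funS _ tTS) => //.
  apply: measurable_fun_lebesgue => //.
  exact: subspace_continuous_measurable_fun.
have [L L0 LL] := sensitivity_lipschitz Lambda_adaptive.
have [K _ kL] := kernel_lipschitz kappa_reg.
apply: measurable_funM; last exact: measurableT_comp.
apply: measurable_funM.
  refine (@measurable_fun_caratheodory_comp _
    (caratheodory_type (wlength (@idfun R))^*%mu) R _ Lambda f L _ _ _ _) => //.
  - by move=> s x y /tTS; exact: LL.
  - move=> x; apply: (lebesgue_measurable_funS _ tTS) => //.
    exact: sensitivity_measurable.
apply: measurable_fun_lebesgue => //.
apply: subspace_continuous_measurable_fun => //.
apply: (@lipschitz_within_continuous _ _ _ K) => x y /=.
rewrite !in_itv/= => /andP[x0 xt] /andP[y0 yt].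
apply: le_trans (kL _ _ _ _) _; rewrite ?in_itv/=; [lra|lra|].
have -> : t - x - (t - y) = y - x by lra.
by rewrite distrC.
Qed.

(** The Lebesgue measure and its completion are restrictions of one and the
    same outer measure, so their values agree by conversion. *)
Lemma completed_lebesgue_measure_itv0 {t} : 0 <= t ->
  @completed_lebesgue_measure R `[0, t] = t%:E.
Proof.
move=> t0; have := @lebesgue_measure_itv R `[0, t].
rewrite /= lte_fin; case: ltgtP t0 => // [_ _|<- _].
- by rewrite -EFinD subr0.
- by [].
Qed.

Lemma memory_functional_defined_continuous f : continuous_set T f ->
  memory_functional_defined T kappa Lambda f.
Proof.
move=> cf t tT; apply: measurable_bounded_integrable.
- exact: sub_caratheodory.
- move: tT; rewrite in_itv/= => /andP[t0 _].
  by rewrite completed_lebesgue_measure_itv0// ltry.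
- exact: memory_integrand_measurable.
- exists (sensitivity_sup T Lambda * kernel_sup T kappa * sup_norm T f).
  split; first exact: num_real.
  move=> M ltM s /= st.
  have /andP[i0 iM] := memory_integrand_bounds cf tT st.
  by rewrite ger0_norm// (le_trans iM)// ltW.
Qed.

Lemma memory_functional_le f : continuous_set T f ->
  (memory_functional T kappa Lambda f
    <= (memory_constant T kappa Lambda * sup_norm T f)%:E)%E.
Proof.
move=> cf; apply: ge_ereal_sup => _ [t tT <-].
set B := sensitivity_sup T Lambda * kernel_sup T kappa * sup_norm T f.
have [t0 tleT] : 0 <= t /\ t <= T.
  by move: (tT : t \in _); rewrite in_itv/= => /andP.
have mt : measurable (`[0, t] :
    set (caratheodory_type (wlength (@idfun R))^*%mu)).
  exact: sub_caratheodory.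
have intB : (\int[@completed_lebesgue_measure R]_(s in `[0%R, t])
    memory_integrand kappa Lambda f t s <= (B * t)%:E)%E.
  rewrite EFinM -(completed_lebesgue_measure_itv0 t0) -integral_cst//.
  apply: ge0_le_integral => //.
  - move=> s st; rewrite lee_fin.
    by have /andP[] := memory_integrand_bounds cf tT st.
  - by apply/measurable_EFinP; exact: memory_integrand_measurable.
  - move=> s st; rewrite lee_fin.
    by have /andP[] := memory_integrand_bounds cf tT st.
apply: le_trans (leeD2l _ intB) _.
rewrite -EFinD lee_fin /memory_constant mulrDl mul1r lerD ?norm_le_sup_norm//.
rewrite [leRHS]mulrAC ler_wpM2l// !mulr_ge0 ?sup_norm_ge0//.
  exact: sensitivity_sup_ge0.
exact: kernel_sup_ge0.
Qed.

End memory.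

Theorem proposition4p1 (R : realType) (T : R) (kappa : R -> R)
    (Lambda : R -> R -> R) (T_gt0 : 0 < T)
    (kappa_reg : regular_kernel T kappa)
    (Lambda_adaptive : adaptive_sensitivity T Lambda) :
  let CI := continuous_set T in
  let M := memory_set T kappa Lambda in
  let S := memory_functional T kappa Lambda in
  let iota := @memory_embedding R in
  let C := memory_constant T kappa Lambda in
  (* iota maps C(I) into M *)
  (forall f, CI f -> M (iota f)) /\
  (* (i) linearity; C(I) is a linear space *)
  (forall (a b : R) f g, CI f -> CI g ->
     CI (fun t => a * f t + b * g t) /\
     iota (fun t => a * f t + b * g t)
       = (fun t => a * iota f t + b * iota g t)) /\
  (* (ii) *)
  (forall f, CI f -> (S (iota f) <= (C * sup_norm T f)%:E)%E) /\
  (* (iii) uniform and Lipschitz continuity; S is defined at iota f - iota g *)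
  [/\ forall f g, CI f -> CI g ->
        memory_functional_defined T kappa Lambda (iota f \- iota g),
      forall eps : R, 0 < eps -> exists2 delta : R, 0 < delta &
        forall f g, CI f -> CI g -> sup_norm T (f \- g) < delta ->
          (S (iota f \- iota g)%R < eps%:E)%E
    & forall f g, CI f -> CI g ->
        (S (iota f \- iota g)%R <= (C * sup_norm T (f \- g)%R)%:E)%E].
Proof.
have Sdef :=
  memory_functional_defined_continuous T_gt0 kappa_reg Lambda_adaptive.
have Sle := memory_functional_le T_gt0 kappa_reg Lambda_adaptive.
have C0 := memory_constant_gt0 T_gt0 kappa_reg Lambda_adaptive.
move=> CI M S iota C; split; [|split; [|split; [|split]]].
- move=> f cf; split; first exact: Sdef.
  by rewrite (le_lt_trans (Sle f cf))// ltry.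
- by move=> a b f g cf cg; split => //; exact: continuous_set_lin.
- exact: Sle.
- by move=> f g cf cg; apply: Sdef; exact: continuous_setB.
- move=> eps eps0; exists (eps / C); first exact: divr_gt0.
  move=> f g cf cg; rewrite ltr_pdivlMr// mulrC => fg.
  by apply: le_lt_trans (Sle _ (continuous_setB cf cg)) _; rewrite lte_fin.
- by move=> f g cf cg; apply: Sle; exact: continuous_setB.
Qed.
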